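(* Let $r>1$ and $b,h>0$, and let $c_\star\in(0,2)$ be the number defined in the context. There exist an open neighbourhood $\mathcal{O}\subset\mathbb{R}^2$ of $(0,0)$, a number $\epsilon_0\in(0,1)$ and a continuous map $$ \gamma:[0,\epsilon_0]\times[0.75\,c_\star,2]\times\mathcal{O}\to\mathbb{R}^2\times C([-2h,0],\mathbb{R})\times\mathbb{R} $$ such that, for each fixed $(\epsilon,c)\in[0,\epsilon_0]\times[0.75\,c_\star,2]$, the map $\gamma(\epsilon,c,\cdot)$ is an embedding of $\mathcal{O}$, and the two-dimensional manifold $\gamma(\epsilon,c,\mathcal{O})$ is contained in the strongly unstable manifold of the zero steady state of the semiflow generated by $$ \begin{aligned} &\phi''(t)-c\phi'(t)+\phi(t)\bigl(1-r-\phi(t)+r\psi(t-ch)\bigr)=0,\\ &\psi''(t)-c\psi'(t)+\bigl(b\phi(t)-\epsilon\psi(t)\bigr)\bigl(1-\psi(t)\bigr)=0. \end{aligned} $$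
   Context: Definition of $c_\star$: for given $b,h>0$, $r>1$ it is known that for all sufficiently small $\epsilon>0$ there are a speed $c=c_*(\epsilon)\in\mathbb{R}$ and a $C^2$ solution $(\phi_\epsilon,\psi_\epsilon):\mathbb{R}\to[0,1]^2$ of the displayed profile system with $c=c_*(\epsilon)$, nondecreasing in each component, with $(\phi_\epsilon,\psi_\epsilon)(-\infty)=(0,0)$ and $(\phi_\epsilon,\psi_\epsilon)(+\infty)=(1,1)$. One such solution is fixed for each small $\epsilon$, and $c_\star:=\liminf_{\epsilon\to0^+}c_*(\epsilon)$; it is known that $0<c_\star<2$. Semiflow: for $c\in(0,2]$ and $\epsilon\ge0$, each quadruple $\mathfrak{q}=(\phi_0,\phi_0',\psi_0(\cdot),\psi_0')\in\mathbb{R}^2\times C([-2h,0],\mathbb{R})\times\mathbb{R}$ determines a unique solution $(\phi(t),\psi(t))$ of the profile system with $\phi(0)=\phi_0$, $\phi'(0)=\phi_0'$, $\psi(s)=\psi_0(s)$ for $s\in[-2h,0]$, $\psi'(0)=\psi_0'$, on some maximal half-open interval of times $t\ge 0$; the semiflow is $\Pi^t\mathfrak{q}=(\phi(t),\phi'(t),\psi(t+\cdot),\psi'(t))$. Zero is a fixed point for all parameter values. The strongly unstable manifold of zero is the set of initial data of negative orbits converging exponentially to $0$ as $t\to-\infty$: i.e. the set of quadruples $(\phi(0),\phi'(0),\psi|_{[-2h,0]},\psi'(0))$, where $(\phi,\psi)$ is a solution of the profile system on $(-\infty,0]$ such that $(\phi(t),\phi'(t),\psi(t+\cdot),\psi'(t))\to0$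 exponentially as $t\to-\infty$. An embedding is a homeomorphism onto its image. *)

(* Defs.v *)
From HB Require Import structures.
From mathcomp Require Import all_boot all_order all_algebra.
From mathcomp Require Import all_classical all_reals all_analysis.

Set Implicit Arguments.
Unset Strict Implicit.
Unset Printing Implicit Defensive.

Import Order.TTheory GRing.Theory Num.Theory.
Import numFieldNormedType.Exports.

Local Open Scope classical_set_scope.
Local Open Scope ring_scope.
Section PhaseSpace.
Context {R : realType}.

(* C([-2h, 0], R), with the topology of uniform convergence. *)
Definition history (h : R) : Type :=
  continuousType (set_type `[- (2 * h), 0]) R.

HB.instance Definition _ (h : R) :=
  PseudoMetric.copy (history h)
    (initial_topology
       (id : continuousType (set_type `[- (2 * h), 0]) R ->
             arrow_uniform_type (set_type `[- (2 * h), 0]) R)).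

Definition history_fun (h : R) (u : history h) :
  set_type `[- (2 * h), 0] -> R := u.

(* Quadruples (phi(0), phi'(0), psi|[-2h, 0], psi'(0)). *)
Definition phase (h : R) : Type := (R * R * history h * R)%type.

End PhaseSpace.

Section ProfileSystem.
Context {R : realType}.
Implicit Types (I : set R) (f phi psi : R -> R) (r b h c eps : R).

(* Derivative relative to I: one-sided at an endpoint of the interval I. *)
Definition derivative_on I f f' :=
  forall t, I t -> (f s - f t) / (s - t) @[s --> within I t^'] --> f' t.

Definition C2_on I f f' f'' :=
  [/\ derivative_on I f f', derivative_on I f' f'' &
      {within I, continuous f''}].

(* phi' and psi' are carried explicitly because they are components of the
   phase-space quadruple.  The interval I is meant to be either the whole line
   or, with c >= 0, a left half-line, so that t - c h stays in I. *)
Definition profile_solution r b h c eps I phi phi' psi psi' :=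
  exists phi'' psi'' : R -> R,
  [/\ C2_on I phi phi' phi'', C2_on I psi psi' psi'' &
      forall t, I t ->
        phi'' t - c * phi' t
          + phi t * (1 - r - phi t + r * psi (t - c * h)) = 0 /\
        psi'' t - c * psi' t + (b * phi t - eps * psi t) * (1 - psi t) = 0].

Definition monotone_wavefront r b h c eps phi psi :=
  [/\ exists phi' psi' : R -> R,
        profile_solution r b h c eps setT phi phi' psi psi',
      forall t, (0 <= phi t <= 1) /\ (0 <= psi t <= 1),
      {homo phi : s t / s <= t} /\ {homo psi : s t / s <= t},
      (phi t @[t --> -oo] --> (0 : R)) /\ (psi t @[t --> -oo] --> (0 : R)) &
      (phi t @[t --> +oo] --> (1 : R)) /\ (psi t @[t --> +oo] --> (1 : R))].

(* Exponential convergence to 0, as t tends to -oo, of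
   (phi(t), phi'(t), psi(t + .), psi'(t)) in the maximum norm. *)
Definition exp_decay h phi phi' psi psi' :=
  exists K delta : R, 0 < delta /\
    forall t, t <= 0 ->
      [/\ `|phi t| <= K * expR (delta * t),
          `|phi' t| <= K * expR (delta * t),
          forall s, - (2 * h) <= s <= 0 ->
            `|psi (t + s)| <= K * expR (delta * t) &
          `|psi' t| <= K * expR (delta * t)].

Definition strongly_unstable_manifold r b h c eps : set (phase h) :=
  [set q | exists (phi phi' psi psi' : R -> R) (u : history h),
    [/\ profile_solution r b h c eps `]-oo, 0] phi phi' psi psi',
        exp_decay h phi phi' psi psi',
        (forall s, history_fun u s = psi (set_val s)) &
        q = (phi 0, phi' 0, u, psi' 0)]].

End ProfileSystem.
Arguments strongly_unstable_manifold {R} r b h c eps.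

(* f restricted to A is a homeomorphism onto f(A), with inverse g. *)
Definition embedding_on {X Y : topologicalType} (A : set X) (f : X -> Y) :=
  exists g : Y -> X,
    [/\ {within A, continuous f}, {within f @` A, continuous g} &
        {in A, cancel f g}].

(* Main.v *)
Require Import Defs.
From HB Require Import structures.
From mathcomp Require Import all_boot all_order all_algebra.
From mathcomp Require Import all_classical all_reals all_analysis.
From mathcomp Require Import ring lra.

(** Solutions that leave zero exponentially are built as convergent sums of
    exponentials e^(nu t) with nu > 0.  On such sums everything in the profile
    system is algebraic: the linear operators phi'' - c phi' - (r - 1) phi and
    psi'' - c psi' - eps psi multiply the coefficient of e^(nu t) by
    nu^2 - c nu - (r - 1) and nu^2 - c nu - eps, the delay multiplies it by
    e^(- nu c h) <= 1, and a product of exponentials adds exponents.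

    Let lam and mu be the positive roots of the two polynomials.  Every
    nonlinear term of the first equation contains phi times phi or psi, hence
    only exponents nu >= lam + mu; the right-hand side of the second one,
    coupling term - b phi included, has only nu >= min(lam, 2 mu).  For
    eps <= (r - 1) / 2 the polynomials stay above a positive constant there
    (charpoly1_ge, charpoly2_ge): no resonance occurs, and the linear
    operators are inverted by dividing coefficients.

    After each division a multiple of e^(lam t), respectively e^(mu t), is
    subtracted so that the result vanishes at t = 0 (solve, solve_at0).  The
    Picard iteration started at the linear solution with phi(0) = A and
    psi(0) = B then keeps these two values, so (phi(0), psi(0)) = (A, B) is
    exactly the parameter of the manifold.  The embedding property is
    therefore immediate: reading off phi(0) and psi(0) is a continuous left
    inverse.

    Convergence is measured by the norm sum |a| e^nu over the terms
    a e^(nu t).  It is multiplicative, and since nu^k <= k! e^nu it controls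
    all derivatives on t <= 0.  For small A and B each Picard correction has
    at most half the norm of the preceding one (correction_norm), uniformly
    in (eps, c, A, B), so the limit exists (limit_pairingP), Taylor
    estimates pass to the limit and give the derivatives (es_value_taylor),
    and the limit depends continuously on the parameters (es_value_near).
    All exponents are at least 3/4 cstar > 0, which is the exponential decay. *)

Set Implicit Arguments.
Unset Strict Implicit.
Unset Printing Implicit Defensive.

Import Order.TTheory GRing.Theory Num.Theory.
Import numFieldNormedType.Exports.

Local Open Scope classical_set_scope.
Local Open Scope ring_scope.

(** * The topology of the history space *)

Lemma history_cvg (R : realType) (h : R) (T : Type) (F : set_system T)
    {FF : Filter F} (f : T -> history h) (u : history h) :
  (forall e : R, 0 < e -> \forall x \near F, forall t,
      `|history_fun u t - history_fun (f x) t| < e) ->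
  f @ F --> u.
Proof.
move=> H; apply/cvg_ballP => e e0; near=> x => /=.
rewrite /ball /= => t.
move: t; near: x; exact: H.
Unshelve. all: by end_near. Qed.

Lemma history_fun_continuous (R : realType) (h : R) t :
  continuous (fun u : history h => history_fun u t).
Proof.
move=> u.
apply/(@cvgrPdist_lt _ _ _ (nbhs u) (nbhs_filter u)) => e e0.
have := nbhsx_ballx u e e0; apply: filterS => v.
by apply.
Qed.

(** * Exponential sums with parameters *)

Section ExponentialSums.
Context {R : realType} {P : topologicalType}.

(** A term is a coefficient and an exponent, both functions of the parameter;
    a sequence of terms stands for the function
    t |-> sum of a(p) e^(nu(p) t). *)
Definition term : Type := ((P -> R) * (P -> R))%type.
Implicit Types (s u : seq term) (p : P) (G H : R -> R).

(** The sequence of terms acts as a discrete measure on exponents.  Taking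
    for G the function nu |-> nu^k e^(nu t) gives the k-th derivative at t;
    other choices give Taylor remainders and the image under a linear
    differential operator. *)
Definition pairing G s p : R := \sum_(x <- s) x.1 p * G (x.2 p).

(** The weight e^nu makes this norm multiplicative, and it leaves room for any
    power of nu, that is, for derivatives. *)
Definition es_norm s p : R := \sum_(x <- s) `|x.1 p| * expR (x.2 p).

Definition es_mul s u : seq term :=
  [seq ((fun p => x.1 p * y.1 p), (fun p => x.2 p + y.2 p)) | x <- s, y <- u].

(** Operators that are diagonal on exponentials: scalar factors, delays,
    inverses of differential operators. *)
Definition es_diag (g : P -> R -> R) s : seq term :=
  [seq ((fun p => x.1 p * g p (x.2 p)), x.2) | x <- s].

Definition expsum (lo : P -> R) s :=
  forall x, x \in s ->
    [/\ continuous x.1, continuous x.2 & forall p, lo p <= x.2 p].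

Lemma pairing_cat G s u p :
  pairing G (s ++ u) p = pairing G s p + pairing G u p.
Proof. by rewrite /pairing big_cat. Qed.

Lemma es_norm_cat s u p : es_norm (s ++ u) p = es_norm s p + es_norm u p.
Proof. by rewrite /es_norm big_cat. Qed.

Lemma pairing_diag G g s p :
  pairing G (es_diag g s) p = pairing (fun nu => g p nu * G nu) s p.
Proof.
by rewrite /pairing big_map; apply: eq_bigr => x _ /=; rewrite mulrA.
Qed.

Lemma pairing_mul G s u p : {morph G : x y / x + y >-> x * y} ->
  pairing G (es_mul s u) p = pairing G s p * pairing G u p.
Proof.
move=> GM; rewrite /pairing big_allpairs_dep big_distrl.
apply: eq_bigr => x _ /=.
by rewrite big_distrr; apply: eq_bigr => y _ /=; rewrite GM mulrACA.
Qed.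

Lemma es_norm_mul s u p : es_norm (es_mul s u) p = es_norm s p * es_norm u p.
Proof.
rewrite /es_norm big_allpairs_dep big_distrl; apply: eq_bigr => x _ /=.
by rewrite big_distrr; apply: eq_bigr => y _ /=; rewrite normrM expRD mulrACA.
Qed.

Lemma es_norm_ge0 s p : 0 <= es_norm s p.
Proof. by apply: sumr_ge0 => x _; rewrite mulr_ge0 ?expR_ge0. Qed.

Lemma eq_pairing lo G H s p : expsum lo s ->
  (forall nu, lo p <= nu -> G nu = H nu) -> pairing G s p = pairing H s p.
Proof.
move=> es GH; rewrite /pairing; apply: eq_big_seq => x /es[_ _ lox].
by rewrite GH.
Qed.

(** Every bound on limits below comes from this one, applied to a suitable
    G. *)
Lemma pairing_le lo G M s p : expsum lo s ->
  (forall nu, lo p <= nu -> `|G nu| <= M * expR nu) ->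
  `|pairing G s p| <= M * es_norm s p.
Proof.
move=> es GM; apply: (le_trans (ler_norm_sum _ _ _)).
rewrite mulr_sumr !big_seq; apply: ler_sum => x /es[_ _ lox].
by rewrite normrM mulrCA ler_wpM2l// GM.
Qed.

Lemma es_norm_diag lo (g : P -> R -> R) M s p : expsum lo s ->
  (forall nu, lo p <= nu -> `|g p nu| <= M) ->
  es_norm (es_diag g s) p <= M * es_norm s p.
Proof.
move=> es gM; rewrite /es_norm big_map mulr_sumr !big_seq.
apply: ler_sum => x /es[_ _ lox] /=.
by rewrite normrM -mulrA mulrCA ler_wpM2r ?mulr_ge0 ?expR_ge0 ?gM.
Qed.

Lemma expsum_cat lo s u : expsum lo s -> expsum lo u -> expsum lo (s ++ u).
Proof. by move=> es eu x; rewrite mem_cat => /orP[/es|/eu]. Qed.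

Lemma expsum_le lo lo' s : (forall p, lo' p <= lo p) -> expsum lo s ->
  expsum lo' s.
Proof.
by move=> ll es x /es[c1 c2 lx]; split => // p; apply: le_trans (lx p).
Qed.

Lemma expsum_mul lo lo' s u : expsum lo s -> expsum lo' u ->
  expsum (fun p => lo p + lo' p) (es_mul s u).
Proof.
move=> es eu _ /allpairsP[[x y] /= [/es[x1 x2 lx] /eu[y1 y2 ly] ->]] /=.
split=> [p|p|p]; last exact: lerD.
- by apply: cvgM; [exact: x1|exact: y1].
- by apply: cvgD; [exact: x2|exact: y2].
Qed.

Lemma expsum_diag lo (g : P -> R -> R) s :
  (forall nu : P -> R, continuous nu -> (forall p, lo p <= nu p) ->
     continuous (fun p => g p (nu p))) ->
  expsum lo s -> expsum lo (es_diag g s).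
Proof.
move=> cg es _ /mapP[x /es[x1 x2 lx] ->] /=; split=> // p.
by apply: cvgM; [exact: x1|exact: cg].
Qed.

Lemma expsum1 lo (c nu : P -> R) : continuous c -> continuous nu ->
  (forall p, lo p <= nu p) -> expsum lo [:: (c, nu)].
Proof. by move=> cc cnu lnu x; rewrite inE => /eqP ->. Qed.

Lemma pairing_continuous lo G s : continuous G -> expsum lo s ->
  continuous (pairing G s).
Proof.
have -> : pairing G s = fun p => \sum_(x <- s | x \in s) x.1 p * G (x.2 p).
  by apply/funext => p; rewrite /pairing big_seq.
move=> cG es p.
apply: cvg_big => [|x /es[x1 x2 _]]; first exact: add_continuous.
by apply: cvgM; [exact: x1|apply: continuous_comp; [exact: x2|exact: cG]].
Qed.

End ExponentialSums.

(** * Elementary estimates *)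

(** The sequences u - 2 C 2^-m and u + 2 C 2^-m are monotone and enclose
    the limit, which yields convergence and its rate together. *)
Lemma geometric_increments_cvg (R : realType) (u : nat -> R) (C : R) :
  (forall m, `|u m.+1 - u m| <= C * 2^-1 ^+ m) ->
  u @ \oo --> lim (u @ \oo) /\
  forall m, `|lim (u @ \oo) - u m| <= 2 * C * 2^-1 ^+ m.
Proof.
move=> uC; pose v m := u m - 2 * C * 2^-1 ^+ m.
pose w m := u m + 2 * C * 2^-1 ^+ m.
have vS m : v m <= v m.+1.
  by rewrite /v exprS; have := uC m; rewrite ler_norml => /andP[]; lra.
have wS m : w m.+1 <= w m.
  by rewrite /w exprS; have := uC m; rewrite ler_norml => /andP[]; lra.
have vh : {homo v : m n / (m <= n)%N >-> m <= n} by exact/nondecreasing_seqP.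
have wh : {homo w : m n / (m <= n)%N >-> n <= m} by exact/nonincreasing_seqP.
have C0 : 0 <= C by have := uC 0; rewrite expr0 mulr1; exact: le_trans.
have h0 m : 0 <= 2 * C * 2^-1 ^+ m by rewrite mulr_ge0 ?exprn_ge0; lra.
have vw m n : v m <= w n.
  have := vh m (maxn m n) (leq_maxl _ _).
  have := wh n (maxn m n) (leq_maxr _ _).
  by have := h0 (maxn m n); rewrite /v /w; lra.
have cv : cvgn v.
  by apply: nondecreasing_is_cvgn => //; exists (w 0) => _ [m _ <-].
have g0 : geometric (2 * C) 2^-1 x @[x --> \oo] --> (0 : R).
  by apply: cvg_geometric; rewrite ger0_norm; lra.
have uv : u = v \+ geometric (2 * C) 2^-1.
  by apply/funext => m; rewrite /v /= subrK.
have ul : u @ \oo --> limn v.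
  by rewrite uv -[X in _ --> X]addr0; exact: cvgD.
have lu : lim (u @ \oo) = limn v by exact: cvg_lim.
rewrite lu; split=> // m; rewrite ler_norml.
have v1 : v m <= limn v by exact: nondecreasing_cvgn_le.
have v2 : limn v <= w m by apply: limr_le => //; near=> n; exact: vw.
by move: v1 v2; rewrite /v /w; lra.
Unshelve. all: by end_near. Qed.

Section ExpEstimates.
Context {R : realType}.
Implicit Types (x y nu t : R).

Lemma expR_lipschitz x y : x <= 0 -> y <= 0 ->
  `|expR y - expR x| <= `|y - x|.
Proof.
wlog xy : x y / x <= y => [H|].
  have [/H //|/ltW yx x0 y0] := leP x y.
  by rewrite distrC (distrC y); exact: H.
move=> x0 y0; rewrite !ger0_norm ?subr_ge0 ?ler_expR//.
have e1 : expR y * (1 + (x - y)) <= expR x.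
  rewrite -[in leRHS](subrKC y x) expRD ler_wpM2l ?expR_ge0//.
  exact: expR_ge1Dx.
have e2 : expR y <= 1 by rewrite expR_le1.
nra.
Qed.

(** With d = y - x, the inequality e^x >= e^y (1 - d) bounds the remainder by
    d (e^y - e^x), and the Lipschitz bound applies to the second factor. *)
Lemma expR_taylor x y : x <= 0 -> y <= 0 ->
  `|expR y - expR x - (y - x) * expR x| <= (y - x) ^+ 2.
Proof.
move=> x0 y0.
have ge0 : 0 <= expR y - expR x - (y - x) * expR x.
  have := expR_ge1Dx (y - x).
  rewrite -(ler_pM2l (expR_gt0 x)) -expRD subrKC; lra.
have e1 : expR y * (1 + (x - y)) <= expR x.
  by rewrite -[in leRHS](subrKC y x) expRD ler_wpM2l ?expR_ge0// expR_ge1Dx.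
rewrite ger0_norm//.
apply: (@le_trans _ _ ((y - x) * (expR y - expR x))); first lra.
rewrite -[leRHS]ger0_norm ?sqr_ge0// normrX expr2.
apply: (le_trans (ler_norm _)); rewrite normrM ler_wpM2l//.
exact: expR_lipschitz.
Qed.

Lemma expn_le_expR k nu : 0 <= nu -> nu ^+ k <= k`!%:R * expR nu.
Proof.
move=> nu0; case: k => [|k].
  by rewrite expr0 fact0 mul1r -expR0 ler_expR.
rewrite -ler_pdivrMl ?ltr0n ?fact_gt0// mulrC.
by apply: le_trans (expR_ge1Dxn k nu0); rewrite lerDr.
Qed.

(** As a function of t, the k-th derivative of e^(nu t). *)
Definition expmono k t nu := nu ^+ k * expR (nu * t).

Lemma expmono_bound k delta t nu : 0 <= delta <= nu -> t <= 0 ->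
  `|expmono k t nu| <= k`!%:R * expR (delta * t) * expR nu.
Proof.
move=> /andP[d0 dn] t0; have nu0 := le_trans d0 dn.
rewrite /expmono normrM (ger0_norm (expR_ge0 _)) ger0_norm ?exprn_ge0//.
rewrite mulrAC; apply: ler_pM; rewrite ?exprn_ge0 ?expR_ge0 ?expn_le_expR//.
by rewrite ler_expR ler_wnM2r.
Qed.

Lemma expmono_taylor k s t nu : 0 <= nu -> s <= 0 -> t <= 0 ->
  `|expmono k s nu - expmono k t nu - (s - t) * expmono k.+1 t nu|
    <= k.+2`!%:R * (s - t) ^+ 2 * expR nu.
Proof.
move=> nu0 s0 t0.
have -> : expmono k s nu - expmono k t nu - (s - t) * expmono k.+1 t nu =
   nu ^+ k * (expR (nu * s) - expR (nu * t) -
     (nu * s - nu * t) * expR (nu * t)).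
  by rewrite /expmono exprS; ring.
rewrite normrM ger0_norm ?exprn_ge0//.
apply: (@le_trans _ _ (nu ^+ k * (nu * s - nu * t) ^+ 2)).
  by rewrite ler_wpM2l ?exprn_ge0// expR_taylor// mulr_ge0_le0.
rewrite -mulrBr exprMn mulrA -exprD addn2 [leRHS]mulrAC ler_wpM2r ?sqr_ge0//.
exact: expn_le_expR.
Qed.

Lemma expmono00 nu : expmono 0 0 nu = 1.
Proof. by rewrite /expmono mulr0 expR0 mulr1. Qed.

Lemma expmono0M t : {morph expmono 0 t : x y / x + y >-> x * y}.
Proof. by move=> x y; rewrite /expmono !expr0 !mul1r mulrDl expRD. Qed.

Lemma expmono_continuous k t : continuous (expmono k t).
Proof.
move=> nu; apply: cvgM; first exact: exprn_continuous.
apply: (continuous_comp (f := fun nu => nu * t)); last exact: continuous_expR.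
exact: mulrr_continuous.
Qed.

End ExpEstimates.

Section DerivativeFromTaylor.
Context {R : realType}.

(** A quadratic remainder is stable under limits of functions, unlike the
    limit of difference quotients: derivatives of series are obtained through
    it. *)
Lemma derivative_on_taylor (I : set R) (f f' : R -> R) (C : R) :
  (forall s t, I s -> I t ->
     `|f s - f t - (s - t) * f' t| <= C * (s - t) ^+ 2) ->
  derivative_on I f f'.
Proof.
move=> fC t It; apply/cvgrPdist_le => e e0.
have C1 : 0 < `|C| + 1 by rewrite ltr_wpDl.
rewrite near_withinE; near=> s => Is.
have st : s - t != 0 by rewrite subr_eq0; near: s; exact: nbhs_dnbhs_neq.
have -> : f' t - (f s - f t) / (s - t) =
    - (f s - f t - (s - t) * f' t) / (s - t) by field.
rewrite mulNr normrN normrM normfV ler_pdivrMr ?normr_gt0//.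
apply: (le_trans (fC _ _ Is It)).
rewrite -real_normK ?num_real// expr2 mulrA ler_wpM2r//.
apply: (@le_trans _ _ ((`|C| + 1) * `|s - t|)).
  by rewrite ler_wpM2r// ler_wpDr// ler_norm.
rewrite -ler_pdivlMl// mulrC; near: s.
apply: nbhs_dnbhs; near do rewrite distrC.
by apply: (@cvgr_dist_le _ R _ (nbhs t) _ id t) => //; rewrite divr_gt0.
Unshelve. all: by end_near. Qed.


Lemma lipschitz_within_continuous (I : set R) (f : R -> R) (C : R) :
  (forall s t, I s -> I t -> `|f s - f t| <= C * `|s - t|) ->
  {within I, continuous f}.
Proof.
move=> fC; apply/subspace_continuousP => t It; apply/cvgrPdist_lt => e e0.
have C1 : 0 < `|C| + 1 by rewrite ltr_wpDl.
rewrite near_withinE; near=> s => Is.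
apply: le_lt_trans (fC _ _ It Is) _.
apply: (@le_lt_trans _ _ ((`|C| + 1) * `|t - s|)).
  by rewrite ler_wpM2r// ler_wpDr// ler_norm.
rewrite -ltr_pdivlMl// mulrC; near: s.
by apply: (@cvgr_dist_lt _ R _ (nbhs t) _ id t) => //; rewrite divr_gt0.
Unshelve. all: by end_near. Qed.

End DerivativeFromTaylor.

(** * Limits of exponential sums *)

Section ExponentialSeries.
Context {R : realType} {P : topologicalType}.
Implicit Types (p : P) (G : R -> R).
Local Notation term := (@term R P).

(** The partial sums S of a series of exponential sums D with geometrically
    decreasing norms; lo is a lower bound for all exponents. *)
Definition exp_series (lo : P -> R) (sigma : R) (S D : nat -> seq term) :=
  [/\ S 0 = [::], forall m, S m.+1 = S m ++ D m,
      forall m, expsum lo (D m) &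
      forall m p, es_norm (D m) p <= sigma * 2^-1 ^+ m].

Variables (lo : P -> R) (sigma : R) (S D : nat -> seq term).
Hypothesis SD : exp_series lo sigma S D.

Lemma exp_series_expsum m : expsum lo (S m).
Proof.
case: SD => S0 SS esD _; elim: m => [|m IH]; first by rewrite S0.
by rewrite SS; exact: expsum_cat.
Qed.

Definition dominated (M : R) G p :=
  forall nu, lo p <= nu -> `|G nu| <= M * expR nu.

Definition limit_pairing G p := lim (pairing G (S m) p @[m --> \oo]).

Lemma limit_pairingP M G p : dominated M G p ->
  pairing G (S m) p @[m --> \oo] --> limit_pairing G p /\
  forall m, `|limit_pairing G p - pairing G (S m) p| <=
    2 * (M * sigma) * 2^-1 ^+ m.
Proof.
move=> GM; case: SD => S0 SS esD nD.
apply: geometric_increments_cvg => m.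
rewrite SS pairing_cat addrC addKr; apply: (le_trans (pairing_le (esD m) GM)).
(* M is nonnegative because the bound holds at nu = lo p. *)
have M0 : 0 <= M.
  by rewrite -(pmulr_lge0 _ (expR_gt0 (lo p))) (le_trans _ (GM _ (lexx _))).
by rewrite -mulrA ler_wpM2l.
Qed.

Lemma limit_pairing_le M G p : dominated M G p ->
  `|limit_pairing G p| <= 2 * (M * sigma).
Proof.
move=> /limit_pairingP[_ /(_ 0)]; case: SD => -> _ _ _.
by rewrite /pairing big_nil subr0 expr0 mulr1.
Qed.

Hypothesis lo_ge0 : forall p, 0 <= lo p.

(** The k-th time derivative of the sum of the series. *)
Definition es_value k p t := limit_pairing (expmono k t) p.

Lemma expmono_dominated k p t : t <= 0 -> dominated k`!%:R (expmono k t) p.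
Proof.
move=> t0 nu lonu; have nu0 := le_trans (lo_ge0 p) lonu.
have := @expmono_bound _ k 0 t nu; rewrite lexx nu0 mul0r expR0 mulr1; exact.
Qed.

Lemma es_value_cvg k p t : t <= 0 ->
  pairing (expmono k t) (S m) p @[m --> \oo] --> es_value k p t.
Proof.
by move=> t0; have [] := limit_pairingP (@expmono_dominated k p t t0).
Qed.

Lemma es_value_decay k delta p t : 0 <= delta <= lo p -> t <= 0 ->
  `|es_value k p t| <= 2 * (k`!%:R * sigma) * expR (delta * t).
Proof.
move=> /andP[d0 dlo] t0; rewrite -mulrA mulrAC.
apply: limit_pairing_le => nu lonu.
by apply: expmono_bound => //; rewrite d0 (le_trans dlo).
Qed.

(** The remainder is itself the pairing of the series with one function of nu,
    so that a bound for a single exponential suffices. *)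
Lemma es_value_taylor k p s t : s <= 0 -> t <= 0 ->
  `|es_value k p s - es_value k p t - (s - t) * es_value k.+1 p t| <=
  2 * (k.+2`!%:R * sigma) * (s - t) ^+ 2.
Proof.
move=> s0 t0.
pose G nu := expmono k s nu - expmono k t nu - (s - t) * expmono k.+1 t nu.
have -> : es_value k p s - es_value k p t - (s - t) * es_value k.+1 p t =
    limit_pairing G p.
  apply/esym/cvg_lim => //.
  have -> : (fun m => pairing G (S m) p) = (fun m =>
      pairing (expmono k s) (S m) p - pairing (expmono k t) (S m) p -
      (s - t) * pairing (expmono k.+1 t) (S m) p).
    apply/funext => m; rewrite /pairing /G mulr_sumr -!sumrB.
    by apply: eq_bigr => x _; ring.
  by apply: cvgB; [apply: cvgB|apply: cvgMr]; exact: es_value_cvg.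
rewrite -mulrA mulrAC; apply: limit_pairing_le => nu lonu.
by apply: expmono_taylor => //; exact: le_trans lonu.
Qed.

Lemma es_value_derivative k p :
  derivative_on `]-oo, 0] (es_value k p) (es_value k.+1 p).
Proof.
apply: derivative_on_taylor => s t; rewrite /= !in_itv /=.
exact: es_value_taylor.
Qed.

Lemma es_value_lipschitz k p s t : s <= 0 -> t <= 0 ->
  `|es_value k p s - es_value k p t| <= 2 * (k.+1`!%:R * sigma) * `|s - t|.
Proof.
move=> s0 t0.
pose G nu := expmono k s nu - expmono k t nu.
have -> : es_value k p s - es_value k p t = limit_pairing G p.
  apply/esym/cvg_lim => //.
  have -> : (fun m => pairing G (S m) p) = (fun m =>
      pairing (expmono k s) (S m) p - pairing (expmono k t) (S m) p).
    apply/funext => m; rewrite /pairing /G -!sumrB.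
    by apply: eq_bigr => x _; ring.
  by apply: cvgB; exact: es_value_cvg.
rewrite -mulrA mulrAC; apply: limit_pairing_le => nu lonu.
have nu0 := le_trans (lo_ge0 p) lonu.
rewrite /G /expmono -mulrBr normrM ger0_norm ?exprn_ge0//.
apply: (@le_trans _ _ (nu ^+ k * `|nu * s - nu * t|)).
  by rewrite ler_wpM2l ?exprn_ge0// expR_lipschitz// mulr_ge0_le0.
rewrite -mulrBr normrM (ger0_norm nu0) mulrA -exprSr [leRHS]mulrAC.
rewrite ler_wpM2r//.
exact: expn_le_expR.
Qed.

Lemma es_value_within_continuous k p :
  {within `]-oo, 0], continuous (es_value k p)}.
Proof.
apply: lipschitz_within_continuous => s t; rewrite /= !in_itv /=.
exact: es_value_lipschitz.
Qed.

Lemma es_value_C2 p :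
  C2_on `]-oo, 0] (es_value 0 p) (es_value 1 p) (es_value 2 p).
Proof.
split; [exact: es_value_derivative|exact: es_value_derivative|].
exact: es_value_within_continuous.
Qed.

(** The convergence is uniform in the parameter and in t, so that
    equicontinuity over the times in A passes to the limit.  Taking for A the
    history interval gives continuity in the uniform norm. *)
Lemma es_value_near k (A : set R) p0 : A `<=` `]-oo, 0] ->
  (forall m e, 0 < e -> \forall p \near p0, forall t, A t ->
     `|pairing (expmono k t) (S m) p0 - pairing (expmono k t) (S m) p| < e) ->
  forall e, 0 < e -> \forall p \near p0, forall t, A t ->
     `|es_value k p0 t - es_value k p t| < e.
Proof.
move=> A0 ASm e e0.
pose C := 2 * (k`!%:R * sigma).
have g0 : geometric C 2^-1 x @[x --> \oo] --> (0 : R).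
  by apply: cvg_geometric; rewrite ger0_norm; lra.
have e3 : 0 < e / 3 by rewrite divr_gt0.
have /cvgrPdist_lt /(_ _ e3) [m _ /(_ m (leqnn _))] := g0.
rewrite /= sub0r normrN => Cm.
have rate p t : A t ->
    `|es_value k p t - pairing (expmono k t) (S m) p| < e / 3.
  move=> /A0; rewrite /= in_itv /= => t0.
  apply: le_lt_trans (le_lt_trans (ler_norm _) Cm).
  by have [_] := limit_pairingP (@expmono_dominated k p t t0); exact.
have := ASm m _ e3; apply: filterS => p pS t At.
have := rate p0 t At; have := rate p t At; have := pS t At.
rewrite !ltr_norml => /andP[? ?] /andP[? ?] /andP[? ?]; lra.
Qed.

Lemma es_value_continuous k t : t <= 0 -> continuous (fun p => es_value k p t).
Proof.
move=> t0 p0; apply/cvgrPdist_lt => e e_gt0.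
have : \forall p \near p0, forall t', [set t] t' ->
    `|es_value k p0 t' - es_value k p t'| < e.
  apply: es_value_near => // [_ -> /=|m d d0]; first by rewrite in_itv /=.
  have cont := pairing_continuous (@expmono_continuous _ k t)
    (@exp_series_expsum m).
  have /cvgrPdist_lt /(_ _ d0) := cont p0.
  by apply: filterS => p pd _ ->.
by apply: filterS => p; apply.
Qed.

End ExponentialSeries.

Section UniformContinuity.
Context {R : realType} {P : topologicalType}.

(** Bound the difference term by term through |a - a'| + T |a| |nu - nu'|,
    which no longer depends on t. *)
Lemma pairing_expR_near (lo : P -> R) (s : seq (@term R P)) (T : R) (p0 : P) :
  (forall p, 0 <= lo p) -> expsum lo s -> 0 <= T ->
  forall e, 0 < e -> \forall p \near p0, forall t, - T <= t <= 0 ->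
    `|pairing (expmono 0 t) s p0 - pairing (expmono 0 t) s p| < e.
Proof.
move=> lo0 es T0 e e0.
pose d p := \sum_(x <- s | x \in s) (`|x.1 p0 - x.1 p| +
     `|x.1 p0| * (T * `|x.2 p0 - x.2 p|)).
have d0 : d p @[p --> p0] --> (0 : R).
  have -> : (0 : R) = \sum_(x <- s | x \in s) 0 by rewrite big1.
  apply: cvg_big => [|x /es[x1 x2 _]]; first exact: add_continuous.
  rewrite -[X in _ --> X]addr0; apply: cvgD.
    apply/norm_cvg0P; rewrite -[X in _ --> X](subrr (x.1 p0)).
    by apply: cvgB; [exact: cvg_cst|exact: x1].
  rewrite -[X in _ --> X](mulr0 (`|x.1 p0|)); apply: cvgMr.
  rewrite -[X in _ --> X](mulr0 T); apply: cvgMr.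
  apply/norm_cvg0P; rewrite -[X in _ --> X](subrr (x.2 p0)).
  by apply: cvgB; [exact: cvg_cst|exact: x2].
have /cvgrPdist_lt /(_ _ e0) := d0; apply: filterS => p.
rewrite sub0r normrN => dp t /andP[Tt t0].
apply: le_lt_trans (le_lt_trans (ler_norm _) dp).
rewrite /pairing -sumrB [in leLHS]big_seq.
apply: (le_trans (ler_norm_sum _ _ _)); apply: ler_sum => x /es[_ _ lox].
rewrite /expmono !expr0 !mul1r.
have n0 q : x.2 q * t <= 0 by rewrite mulr_ge0_le0// (le_trans (lo0 q)).
have -> : x.1 p0 * expR (x.2 p0 * t) - x.1 p * expR (x.2 p * t) =
  (x.1 p0 - x.1 p) * expR (x.2 p * t) +
  x.1 p0 * (expR (x.2 p0 * t) - expR (x.2 p * t)) by ring.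
apply: (le_trans (ler_normD _ _)); rewrite !normrM; apply: lerD.
  by rewrite ler_piMr// ger0_norm ?expR_ge0// expR_le1.
rewrite ler_wpM2l//; apply: (le_trans (expR_lipschitz _ _)) => //.
rewrite -mulrBl normrM mulrC ler_wpM2r// ler_norml; lra.
Qed.

End UniformContinuity.

(** * Inverting the linear operators *)

Section LinearSolve.
Context {R : realType} {P : topologicalType}.
Local Notation term := (@term R P).
Implicit Types (p : P) (s : seq term).

Variables (c m : P -> R).
Hypotheses (c_cont : continuous c) (m_cont : continuous m).
Hypotheses (c_gt0 : forall p, 0 < c p) (m_ge0 : forall p, 0 <= m p).

Definition charpoly p (nu : R) := nu ^+ 2 - c p * nu - m p.

Definition unstable_root p := (c p + Num.sqrt (c p ^+ 2 + 4 * m p)) / 2.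

Lemma charpoly_root p : charpoly p (unstable_root p) = 0.
Proof.
have d0 : 0 <= c p ^+ 2 + 4 * m p by rewrite addr_ge0 ?sqr_ge0 ?mulr_ge0.
have := sqr_sqrtr d0; rewrite /charpoly /unstable_root.
set q := Num.sqrt _ => q2.
have -> : ((c p + q) / 2) ^+ 2 - c p * ((c p + q) / 2) - m p =
  (q ^+ 2 - (c p ^+ 2 + 4 * m p)) / 4 by field.
by rewrite q2 subrr mul0r.
Qed.

Lemma unstable_root_ge p : c p <= unstable_root p.
Proof.
have : Num.sqrt (c p ^+ 2) <= Num.sqrt (c p ^+ 2 + 4 * m p).
  by rewrite ler_wsqrtr// lerDl mulr_ge0.
by rewrite sqrtr_sqr (ger0_norm (ltW (c_gt0 p))) /unstable_root; lra.
Qed.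

Lemma unstable_root_le p : unstable_root p <= c p + m p + 1.
Proof.
have := charpoly_root p; rewrite /charpoly => q; have := unstable_root_ge p.
have := c_gt0 p; have := m_ge0 p; nra.
Qed.

Lemma unstable_root_continuous : continuous unstable_root.
Proof.
move=> p; apply: cvgMl; apply: cvgD; first exact: c_cont.
apply: (continuous_comp (f := fun p => c p ^+ 2 + 4 * m p)); last first.
  exact: sqrt_continuous.
apply: cvgD; last by apply: cvgMr; exact: m_cont.
by apply: cvgM; exact: c_cont.
Qed.

(** The vertex of the parabola is at c / 2. *)
Lemma charpoly_homo p nu nu' : c p <= nu -> nu <= nu' ->
  charpoly p nu <= charpoly p nu'.
Proof. by rewrite /charpoly; have := c_gt0 p; nra. Qed.

Lemma charpoly_continuous (nu : P -> R) :
  continuous nu -> continuous (fun p => charpoly p (nu p)).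
Proof.
move=> nuc p; apply: cvgB; last exact: m_cont.
apply: cvgB; first by apply: cvgM; exact: nuc.
by apply: cvgM; [exact: c_cont|exact: nuc].
Qed.

(** The particular solution of v'' - c v' - m v = s given by division. *)
Definition es_div s := es_diag (fun p nu => (charpoly p nu)^-1) s.

(** The added multiple of e^(root t) solves the homogeneous equation and makes
    the sum vanish at t = 0. *)
Definition solve s : seq term := es_div s ++
  [:: ((fun p => - pairing (expmono 0 0) (es_div s) p), unstable_root)].

(** Below, w is a floor for the exponents of the right-hand side, above which
    the polynomial is bounded away from 0. *)
Variables (w : P -> R) (kappa Lambda : R).
Hypotheses (w_ge0 : forall p, 0 <= w p) (kappa_gt0 : 0 < kappa).
Hypothesis charpoly_ge : forall p nu, w p <= nu -> kappa <= charpoly p nu.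
Hypothesis root_le : forall p, unstable_root p <= Lambda.

Lemma solve_ode s p t : expsum w s ->
  pairing (fun nu => charpoly p nu * expmono 0 t nu) (solve s) p =
  pairing (expmono 0 t) s p.
Proof.
move=> es; rewrite pairing_cat pairing_diag.
rewrite [X in _ + X]/pairing big_seq1 /= charpoly_root mul0r mulr0 addr0.
apply: (eq_pairing es) => nu wnu; rewrite mulrA mulVf ?mul1r//.
by rewrite gt_eqF// (lt_le_trans kappa_gt0)// charpoly_ge.
Qed.

Lemma solve_at0 s p : pairing (expmono 0 0) (solve s) p = 0.
Proof.
rewrite pairing_cat [X in _ + X]/pairing big_seq1 /=.
by rewrite expmono00 mulr1 subrr.
Qed.

Lemma charpolyV_le p nu : w p <= nu -> `|(charpoly p nu)^-1| <= kappa^-1.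
Proof.
move=> /charpoly_ge k; have k0 := lt_le_trans kappa_gt0 k.
by rewrite ger0_norm ?invr_ge0 ?(ltW k0)// lef_pV2.
Qed.

Lemma expsum_div s : expsum w s -> expsum w (es_div s).
Proof.
apply: expsum_diag => nu nuc wnu p.
apply: cvgV; last exact: charpoly_continuous.
by rewrite gt_eqF// (lt_le_trans kappa_gt0)// charpoly_ge.
Qed.

Lemma solve_expsum lo s : (forall p, lo p <= w p) ->
  (forall p, lo p <= unstable_root p) -> expsum w s -> expsum lo (solve s).
Proof.
move=> low lor /expsum_div es; apply: expsum_cat; first exact: expsum_le es.
apply: expsum1 => //; last exact: unstable_root_continuous.
have pc := pairing_continuous (@expmono_continuous _ 0 0) es.
by move=> p; apply: cvgN; exact: pc.
Qed.

Lemma solve_norm s p : expsum w s ->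
  es_norm (solve s) p <= kappa^-1 * (1 + expR Lambda) * es_norm s p.
Proof.
move=> es; have ed := expsum_div es.
have nd : es_norm (es_div s) p <= kappa^-1 * es_norm s p.
  by apply: (es_norm_diag es) => nu; exact: charpolyV_le.
rewrite es_norm_cat [X in _ + X]/es_norm big_seq1 /= normrN.
have p1 : `|pairing (expmono 0 0) (es_div s) p| <= es_norm (es_div s) p.
  rewrite -[leRHS]mul1r; apply: (pairing_le ed) => nu wnu.
  rewrite expmono00 normr1 mul1r.
  by rewrite -expR0 ler_expR (le_trans _ wnu).
rewrite mulrAC mulrDr mulr1; apply: lerD => //.
by apply: ler_pM; rewrite ?expR_ge0 ?ler_expR ?(le_trans p1).
Qed.

End LinearSolve.

(** * The Picard iteration for the profile system *)

Section WaveSeries.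
Context {R : realType} {P : topologicalType}.
Local Notation term := (@term R P).
Implicit Types (p : P) (s : seq term) (u v : seq term * seq term).

Variables (r b h c0 e0 : R) (eps c A B : P -> R).
Hypotheses (hr : 1 < r) (hb : 0 < b) (hh : 0 < h) (hc0 : 0 < c0).
Hypotheses (eps_cont : continuous eps) (c_cont : continuous c).
Hypotheses (A_cont : continuous A) (B_cont : continuous B).
Hypothesis c_bounds : forall p, c0 <= c p <= 2.
Hypotheses (e0_le1 : e0 <= 1) (e0_gap : e0 <= (r - 1) / 2).
Hypothesis eps_bounds : forall p, 0 <= eps p <= e0.

(** The linear part of the first equation is
    phi'' - c phi' - phi_mass phi. *)
Definition phi_mass : P -> R := fun=> r - 1.
Definition lam := unstable_root c phi_mass.
Definition mu := unstable_root c eps.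

Lemma phi_mass_ge0 p : 0 <= phi_mass p.
Proof. by rewrite subr_ge0 ltW. Qed.
Lemma eps_ge0 p : 0 <= eps p. Proof. by have /andP[] := eps_bounds p. Qed.
Lemma r_gt0 : 0 < r. Proof. exact: (lt_trans ltr01 hr). Qed.
Lemma eps_le1 p : eps p <= 1.
Proof. by have /andP[_ h1] := eps_bounds p; exact: le_trans e0_le1. Qed.
Lemma eps_gap p : eps p <= (r - 1) / 2.
Proof. by have /andP[_ h1] := eps_bounds p; exact: le_trans e0_gap. Qed.
Lemma c_gt0 p : 0 < c p.
Proof. by have /andP[h1 _] := c_bounds p; exact: lt_le_trans h1. Qed.
Lemma phi_mass_cont : continuous phi_mass.
Proof. by move=> p; exact: cvg_cst. Qed.
Lemma lam_cont : continuous lam.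
Proof. exact: (unstable_root_continuous c_cont phi_mass_cont). Qed.
Lemma mu_cont : continuous mu.
Proof. exact: (unstable_root_continuous c_cont eps_cont). Qed.

Lemma mu_ge p : c0 <= mu p.
Proof.
have /andP[h1 _] := c_bounds p; apply: (le_trans h1).
exact: (unstable_root_ge c_gt0 eps_ge0).
Qed.

Lemma mu_le_lam p : mu p <= lam p.
Proof.
rewrite /mu /lam /unstable_root ler_pM2r ?invr_gt0// lerD2l ler_wsqrtr//.
by have := eps_gap p; have := hr; rewrite /phi_mass /=; lra.
Qed.

Lemma lam_le p : lam p <= r + 2.
Proof.
have /andP[_ c2] := c_bounds p.
have := unstable_root_le c_gt0 phi_mass_ge0 p; rewrite -/lam /phi_mass /=; lra.
Qed.

Lemma mu_le p : mu p <= r + 2.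
Proof. exact: le_trans (mu_le_lam p) (lam_le p). Qed.
Lemma mu_ge0 p : 0 <= mu p.
Proof. exact: le_trans (ltW hc0) (mu_ge p). Qed.
Lemma lam_ge0 p : 0 <= lam p.
Proof. exact: le_trans (mu_ge0 p) (mu_le_lam p). Qed.

Definition gap : R := Num.min ((r - 1) / 2) (2 * c0 ^+ 2).

(** Floors for the exponents of the right-hand sides of the two equations. *)
Definition floor1 p := lam p + mu p.
Definition floor2 p := Num.min (lam p) (2 * mu p).

Lemma gap_gt0 : 0 < gap.
Proof.
rewrite lt_min; apply/andP; split.
  by rewrite divr_gt0 ?subr_gt0.
by rewrite mulr_gt0 ?exprn_gt0.
Qed.

(** At nu = lam + mu the equations of the two roots give the value
    2 lam mu + eps. *)
Lemma charpoly1_ge p nu : floor1 p <= nu -> gap <= charpoly c phi_mass p nu.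
Proof.
move=> wnu; apply: le_trans (charpoly_homo phi_mass c_gt0 _ wnu); last first.
  have := unstable_root_ge c_gt0 eps_ge0 p; rewrite -/mu /floor1.
  by have := lam_ge0 p; lra.
rewrite ge_min; apply/orP; right.
have := charpoly_root c phi_mass_ge0 p; have := charpoly_root c eps_ge0 p.
rewrite -/lam -/mu /charpoly /floor1 => h1 h2.
have : c0 ^+ 2 <= lam p * mu p.
  rewrite expr2; apply: ler_pM; rewrite ?(ltW hc0) ?mu_ge//.
  exact: le_trans (mu_ge p) (mu_le_lam p).
have := eps_ge0 p; nra.
Qed.

(** At nu = lam the value is (r - 1) - eps, and at nu = 2 mu it is
    2 mu^2 + eps; this is where eps has to stay away from r - 1. *)
Lemma charpoly2_ge p nu : floor2 p <= nu -> gap <= charpoly c eps p nu.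
Proof.
have := charpoly_root c phi_mass_ge0 p; have := charpoly_root c eps_ge0 p.
have cmu := unstable_root_ge c_gt0 eps_ge0 p.
rewrite -/lam -/mu in cmu * => h1 h2.
rewrite ge_min => /orP[] wnu.
  apply: le_trans (charpoly_homo eps c_gt0 _ wnu); last first.
    exact: le_trans cmu (mu_le_lam p).
  rewrite ge_min; apply/orP; left.
  by have := eps_gap p; move: h2; rewrite /charpoly /phi_mass /=; lra.
apply: le_trans (charpoly_homo eps c_gt0 _ wnu); last by have := mu_ge0 p; lra.
rewrite ge_min; apply/orP; right.
have : c0 ^+ 2 <= mu p ^+ 2.
  by rewrite lerXn2r ?nnegrE ?mu_ge0 ?(ltW hc0) ?mu_ge.
by move: h1; rewrite /charpoly; have := eps_ge0 p; nra.
Qed.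

Definition scale (k : P -> R) s := es_diag (fun p _ => k p) s.
Definition delay s := es_diag (fun p nu => expR (nu * - (c p * h))) s.
Definition pair_cat u v := (u.1 ++ v.1, u.2 ++ v.2).

(** Bilinear forms of the quadratic right-hand sides: on the diagonal they are
    phi (phi - r psi(t - c h)) and (b phi - eps psi) psi, while the linear
    coupling - b phi is treated separately. *)
Definition nonlin1 u v := es_mul u.1 (v.1 ++ scale (fun=> - r) (delay v.2)).
Definition nonlin2 u v :=
  es_mul (scale (fun=> b) u.1 ++ scale (fun p => - eps p) u.2) v.2.

(** With Q the quadratic form of a bilinear B, one has
    Q(u + v) - Q(u) = B(u + v, v) + B(v, u): this solves for the next
    increment when u is the current sum and v the current increment.  The
    coupling uses the increment of phi just computed; it is not small, but it
    is triangular. *)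
Definition correction u v :=
  let d1 := solve c phi_mass (nonlin1 (pair_cat u v) v ++ nonlin1 v u) in
  (d1, solve c eps (scale (fun=> - b) d1 ++
         (nonlin2 (pair_cat u v) v ++ nonlin2 v u))).

(** The solution of the linearized system with phi(0) = A and psi(0) = B. *)
Definition linear_part : seq term * seq term :=
  let d1 := [:: (A, lam)] in
  (d1, solve c eps (scale (fun=> - b) d1) ++ [:: (B, mu)]).

(** The state is the sum of the first k increments together with the next
    increment. *)
Definition picard (k : nat) :=
  iter k (fun st => (pair_cat st.1 st.2, correction st.1 st.2))
         (([::], [::]), linear_part).

Definition picard_sum k := (picard k).1.
Definition picard_step k := (picard k).2.

Definition es_eval s p t := pairing (expmono 0 t) s p.

Lemma es_eval_cat s s' p t :
  es_eval (s ++ s') p t = es_eval s p t + es_eval s' p t.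
Proof. exact: pairing_cat. Qed.

Lemma es_eval_scale k s p t : es_eval (scale k s) p t = k p * es_eval s p t.
Proof.
rewrite /es_eval pairing_diag /pairing mulr_sumr.
by apply: eq_bigr => x _; rewrite mulrCA.
Qed.

Lemma es_eval_delay s p t : es_eval (delay s) p t = es_eval s p (t - c p * h).
Proof.
rewrite /es_eval pairing_diag; apply: eq_bigr => x _.
rewrite /expmono !expr0 !mul1r.
by rewrite -expRD -mulrDr addrC.
Qed.

Lemma es_eval_nonlin1 u v p t :
  es_eval (nonlin1 u v) p t =
  es_eval u.1 p t * (es_eval v.1 p t - r * es_eval v.2 p (t - c p * h)).
Proof.
rewrite {1}/es_eval pairing_mul; last exact: expmono0M.
by rewrite -!/(es_eval _ _ _) es_eval_cat es_eval_scale es_eval_delay mulNr.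
Qed.

Lemma es_eval_nonlin2 u v p t :
  es_eval (nonlin2 u v) p t =
  (b * es_eval u.1 p t - eps p * es_eval u.2 p t) * es_eval v.2 p t.
Proof.
rewrite {1}/es_eval pairing_mul; last exact: expmono0M.
by rewrite -!/(es_eval _ _ _) es_eval_cat !es_eval_scale mulNr.
Qed.

Definition admissible u := expsum lam u.1 /\ expsum mu u.2.

Lemma expsum_scale (k : P -> R) lo s :
  continuous k -> expsum lo s -> expsum lo (scale k s).
Proof. by move=> kc; apply: expsum_diag => nu _ _; exact: kc. Qed.

Lemma expsum_delay lo s : expsum lo s -> expsum lo (delay s).
Proof.
apply: expsum_diag => nu nuc _ p.
apply: (continuous_comp (f := fun p => nu p * - (c p * h))); last first.
  exact: continuous_expR.
apply: cvgM; first exact: nuc.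
by apply: cvgN; apply: cvgMl; exact: c_cont.
Qed.

Lemma cst_cont (k : R) : continuous (fun _ : P => k).
Proof. by move=> p; exact: cvg_cst. Qed.

Lemma epsN_cont : continuous (fun p => - eps p).
Proof. by move=> p; apply: cvgN; exact: eps_cont. Qed.

Lemma expsum_nonlin1 u v :
  admissible u -> admissible v -> expsum floor1 (nonlin1 u v).
Proof.
move=> [u1 u2] [v1 v2]; apply: expsum_mul => //; apply: expsum_cat.
  exact: expsum_le mu_le_lam v1.
by apply: expsum_scale; [exact: cst_cont|exact: expsum_delay].
Qed.

Lemma expsum_nonlin2 u v :
  admissible u -> admissible v -> expsum floor2 (nonlin2 u v).
Proof.
move=> [u1 u2] [v1 v2].
apply: (@expsum_le _ _ (fun p => mu p + mu p)) => [p|].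
  by rewrite ge_min mulr_natl mulr2n lexx orbT.
apply: expsum_mul => //; apply: expsum_cat; apply: expsum_scale => //.
- exact: cst_cont.
- exact: expsum_le mu_le_lam u1.
- exact: epsN_cont.
Qed.

Lemma admissible_cat u v :
  admissible u -> admissible v -> admissible (pair_cat u v).
Proof. by move=> [u1 u2] [v1 v2]; split; exact: expsum_cat. Qed.

Lemma expsum_coupling s :
  expsum lam s -> expsum floor2 (scale (fun=> - b) s).
Proof.
move=> es; apply: expsum_scale; first exact: cst_cont.
by apply: expsum_le es => p; rewrite ge_min lexx.
Qed.

Lemma expsum_source1 u v : admissible u -> admissible v ->
  expsum floor1 (nonlin1 (pair_cat u v) v ++ nonlin1 v u).
Proof.
move=> gu gv; apply: expsum_cat; apply: expsum_nonlin1 => //.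
exact: admissible_cat.
Qed.

Lemma expsum_source2 s u v : expsum lam s -> admissible u -> admissible v ->
  expsum floor2 (scale (fun=> - b) s ++
    (nonlin2 (pair_cat u v) v ++ nonlin2 v u)).
Proof.
move=> es gu gv; apply: expsum_cat; first exact: expsum_coupling.
apply: expsum_cat; apply: expsum_nonlin2 => //.
exact: admissible_cat.
Qed.

Definition pnorm u p := es_norm u.1 p + es_norm u.2 p.

Lemma pnorm_ge0 u p : 0 <= pnorm u p.
Proof. by rewrite addr_ge0 ?es_norm_ge0. Qed.

Lemma pnorm_add u v p : pnorm (pair_cat u v) p = pnorm u p + pnorm v p.
Proof. by rewrite /pnorm !es_norm_cat addrACA. Qed.

Lemma es_norm_scale lo k M s p : expsum lo s -> `|k p| <= M ->
  es_norm (scale k s) p <= M * es_norm s p.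
Proof. by move=> es kM; apply: (es_norm_diag es). Qed.

Lemma es_norm_delay s p : expsum mu s -> es_norm (delay s) p <= es_norm s p.
Proof.
move=> es; rewrite -[leRHS]mul1r; apply: (es_norm_diag es) => nu munu.
rewrite ger0_norm ?expR_ge0// expR_le1.
rewrite mulr_ge0_le0 ?oppr_le0 ?mulr_ge0 ?(ltW hh)//.
  exact: le_trans (mu_ge0 p) munu.
exact: ltW (c_gt0 p).
Qed.

Lemma nonlin1_norm u v p : admissible u -> admissible v ->
  es_norm (nonlin1 u v) p <= r * pnorm u p * pnorm v p.
Proof.
move=> [u1 u2] [v1 v2]; rewrite es_norm_mul (mulrC r) -mulrA.
apply: ler_pM; rewrite ?es_norm_ge0//; first by rewrite lerDl es_norm_ge0.
rewrite es_norm_cat mulrDr; apply: lerD.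
  by rewrite ler_peMl ?es_norm_ge0// ltW.
apply: (@le_trans _ _ (r * es_norm (delay v.2) p)).
  apply: (es_norm_scale (expsum_delay v2)).
  by rewrite normrN ger0_norm// ltW// r_gt0.
by rewrite ler_wpM2l ?es_norm_delay// ltW// r_gt0.
Qed.

Lemma nonlin2_norm u v p : admissible u -> admissible v ->
  es_norm (nonlin2 u v) p <= (b + 1) * pnorm u p * pnorm v p.
Proof.
move=> [u1 u2] [v1 v2]; rewrite es_norm_mul.
apply: ler_pM; rewrite ?es_norm_ge0//; last by rewrite lerDr es_norm_ge0.
rewrite es_norm_cat mulrDr.
have n1 := es_norm_ge0 u.1 p; have n2 := es_norm_ge0 u.2 p.
apply: lerD.
  apply: (@le_trans _ _ (b * es_norm u.1 p)); last by rewrite ler_wpM2r// lerDl.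
  by apply: (es_norm_scale u1); rewrite ger0_norm// ltW.
apply: (@le_trans _ _ (1 * es_norm u.2 p)); last first.
  by rewrite ler_wpM2r// lerDr ltW.
have eps0 := eps_ge0 p; have eps1 := eps_le1 p.
by apply: (es_norm_scale u2); rewrite normrN ger0_norm.
Qed.

(** A bound for the norm of solve: division costs a factor 1 / gap, and the
    boundary term costs e^(root) with root <= r + 2. *)
Definition gain : R := gap^-1 * (1 + expR (r + 2)).
(** Chosen so that 4 radius times the bracket is 1/2, where the bracket
    collects the constants of the quadratic terms after solving. *)
Definition radius : R :=
  (8 * (gain * r + gain * (b * (gain * r)) + gain * (b + 1)))^-1.
Definition amplitude : R := radius / (expR (r + 2) * (2 + gain * b)).

Lemma gain_gt0 : 0 < gain.
Proof. by rewrite mulr_gt0 ?invr_gt0 ?gap_gt0 ?addr_gt0 ?expR_gt0. Qed.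

Lemma bracket_gt0 : 0 < gain * r + gain * (b * (gain * r)) + gain * (b + 1).
Proof.
have k0 := gain_gt0; have h1 := mulr_gt0 k0 r_gt0.
have h2 := mulr_gt0 k0 (mulr_gt0 hb h1).
have h3 := mulr_gt0 k0 (addr_gt0 hb ltr01).
exact: addr_gt0 (addr_gt0 h1 h2) h3.
Qed.

Lemma radius_gt0 : 0 < radius.
Proof. by rewrite invr_gt0 mulr_gt0 ?bracket_gt0. Qed.

Lemma amplitude_gt0 : 0 < amplitude.
Proof.
apply: divr_gt0 radius_gt0 (mulr_gt0 (expR_gt0 _) (addr_gt0 _ _)) => //.
exact: mulr_gt0 gain_gt0 hb.
Qed.

Lemma floor1_ge0 p : 0 <= floor1 p.
Proof. by rewrite addr_ge0 ?lam_ge0 ?mu_ge0. Qed.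
Lemma floor2_ge0 p : 0 <= floor2 p.
Proof. by rewrite le_min lam_ge0 mulr_ge0 ?mu_ge0. Qed.
Lemma mu_le_floor2 p : mu p <= floor2 p.
Proof. by rewrite le_min mu_le_lam /=; have := mu_ge0 p; lra. Qed.
Lemma lam_le_floor1 p : lam p <= floor1 p. Proof. by rewrite lerDl mu_ge0. Qed.

Lemma solve1_expsum s : expsum floor1 s -> expsum lam (solve c phi_mass s).
Proof.
by apply: (solve_expsum c_cont phi_mass_cont gap_gt0 charpoly1_ge
  lam_le_floor1) => p.
Qed.

Lemma solve2_expsum s : expsum floor2 s -> expsum mu (solve c eps s).
Proof.
by apply: (solve_expsum c_cont eps_cont gap_gt0 charpoly2_ge
  mu_le_floor2) => p.
Qed.

Lemma solve1_norm s p : expsum floor1 s ->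
  es_norm (solve c phi_mass s) p <= gain * es_norm s p.
Proof.
exact: (solve_norm c_cont phi_mass_cont floor1_ge0 gap_gt0 charpoly1_ge lam_le).
Qed.

Lemma solve2_norm s p : expsum floor2 s ->
  es_norm (solve c eps s) p <= gain * es_norm s p.
Proof.
exact: (solve_norm c_cont eps_cont floor2_ge0 gap_gt0 charpoly2_ge mu_le).
Qed.

Lemma correction_admissible u v :
  admissible u -> admissible v -> admissible (correction u v).
Proof.
move=> gu gv.
have g1 : expsum lam (correction u v).1.
  by apply: solve1_expsum; exact: expsum_source1.
by split=> //; apply: solve2_expsum; exact: expsum_source2.
Qed.

(** Each quadratic term contains one factor v and another factor whose norm is
    at most 2 radius. *)
Lemma correction_norm u v p : admissible u -> admissible v ->
  pnorm u p + pnorm v p <= 2 * radius ->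
  pnorm (correction u v) p <= pnorm v p / 2.
Proof.
move=> gu gv uv.
have gp := admissible_cat gu gv.
have [g1 _] := correction_admissible gu gv.
have pu := pnorm_ge0 u p; have pv := pnorm_ge0 v p.
have n1 : es_norm (correction u v).1 p <=
    gain * (es_norm (nonlin1 (pair_cat u v) v) p + es_norm (nonlin1 v u) p).
  by rewrite -es_norm_cat; apply: solve1_norm; exact: expsum_source1.
have n2 : es_norm (correction u v).2 p <=
    gain * (es_norm (scale (fun=> - b) (correction u v).1) p +
      (es_norm (nonlin2 (pair_cat u v) v) p + es_norm (nonlin2 v u) p)).
  by rewrite -!es_norm_cat; apply: solve2_norm; exact: expsum_source2.
have a1 := nonlin1_norm p gp gv; have a2 := nonlin1_norm p gv gu.
have b1 := nonlin2_norm p gp gv; have b2 := nonlin2_norm p gv gu.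
rewrite pnorm_add in a1 b1.
have s1 : es_norm (scale (fun=> - b) (correction u v).1) p <=
    b * es_norm (correction u v).1 p.
  by apply: (es_norm_scale g1); rewrite normrN ger0_norm// ltW.
set N1 := es_norm (correction u v).1 p in s1 n1 *.
have r0 := r_gt0; have k0 := gain_gt0; have b0 := hb.
have N1le : N1 <= gain * (r * (4 * radius * pnorm v p)).
  apply: (le_trans n1); rewrite ler_wpM2l ?(ltW k0)//.
  apply: (le_trans (lerD a1 a2)).
  rewrite -!mulrA -mulrDr ler_wpM2l ?(ltW r0)//; nra.
have N2le : es_norm (correction u v).2 p <= gain * (b * N1 +
    (b + 1) * (4 * radius * pnorm v p)).
  apply: (le_trans n2); rewrite ler_wpM2l ?(ltW k0)//.
  apply: lerD => //; apply: (le_trans (lerD b1 b2)).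
  by rewrite -!mulrA -mulrDr ler_wpM2l ?addr_ge0 ?(ltW b0)//; nra.
rewrite /pnorm -/N1; apply: (le_trans (lerD N1le N2le)).
have m0 := bracket_gt0.
apply: (@le_trans _ _ ((gain * r + gain * (b * (gain * r)) + gain * (b + 1)) *
    (4 * radius) * pnorm v p)); last first.
  suff -> : (gain * r + gain * (b * (gain * r)) + gain * (b + 1)) *
    (4 * radius) = 2^-1 by rewrite mulrC.
  rewrite /radius; field; exact: lt0r_neq0.
have := ler_wpM2l (ltW (mulr_gt0 k0 b0)) N1le; lra.
Qed.

Hypothesis A_small : forall p, `|A p| <= amplitude.
Hypothesis B_small : forall p, `|B p| <= amplitude.

Lemma linear_part_admissible : admissible linear_part.
Proof.
have g1 : expsum lam [:: (A, lam)].
  by apply: expsum1 => //; exact: lam_cont.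
split=> //; apply: expsum_cat.
  by apply: solve2_expsum; exact: expsum_coupling.
by apply: expsum1 => //; exact: mu_cont.
Qed.

Lemma linear_part_norm p : pnorm linear_part p <= radius.
Proof.
have [g1 _] := linear_part_admissible.
have n2 := solve2_norm p (expsum_coupling g1).
have s1 : es_norm (scale (fun=> - b) [:: (A, lam)]) p <=
    b * es_norm [:: (A, lam)] p.
  by apply: (es_norm_scale g1); rewrite normrN ger0_norm// ltW.
have k0 := gain_gt0; have b0 := hb.
have en (a : P -> R) nu : `|a p| <= amplitude -> nu p <= r + 2 ->
    es_norm [:: (a, nu)] p <= amplitude * expR (r + 2).
  move=> ha hnu; rewrite /es_norm big_seq1 /=.
  by apply: ler_pM; rewrite ?expR_ge0 ?ler_expR.
have nA := en A lam (A_small p) (lam_le p).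
have nB := en B mu (B_small p) (mu_le p).
have -> : pnorm linear_part p = es_norm [:: (A, lam)] p +
    (es_norm (solve c eps (scale (fun=> - b) [:: (A, lam)])) p +
     es_norm [:: (B, mu)] p) by rewrite -es_norm_cat.
have -> : radius = amplitude * expR (r + 2) * (2 + gain * b).
  rewrite /amplitude; field; rewrite !lt0r_neq0 ?expR_gt0//.
  by rewrite addr_gt0// mulr_gt0.
have n3 : es_norm (solve c eps (scale (fun=> - b) [:: (A, lam)])) p <=
    gain * (b * (amplitude * expR (r + 2))).
  apply: (le_trans n2); rewrite ler_wpM2l ?(ltW k0)//.
  by apply: (le_trans s1); rewrite ler_wpM2l ?(ltW b0).
lra.
Qed.

Lemma picardS k : picard k.+1 =
  (pair_cat (picard_sum k) (picard_step k),
   correction (picard_sum k) (picard_step k)).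
Proof. by []. Qed.

Lemma picard_bounds k :
  [/\ admissible (picard_sum k), admissible (picard_step k) &
  forall p, pnorm (picard_step k) p <= radius * 2^-1 ^+ k /\
    pnorm (picard_sum k) p + 2 * radius * 2^-1 ^+ k <= 2 * radius].
Proof.
elim: k => [|k [gU gD n]].
  split; [by []|exact: linear_part_admissible|move=> p].
  rewrite expr0 !mulr1 /pnorm /es_norm !big_nil !add0r; split=> //.
  exact: linear_part_norm.
have gC := correction_admissible gU gD.
split; rewrite /picard_sum /picard_step picardS /=.
- exact: admissible_cat.
- exact: gC.
- move=> p; have [n1 n2] := n p; rewrite pnorm_add exprS.
  have g0 : 0 <= radius * 2^-1 ^+ k.
    by rewrite mulr_ge0 ?exprn_ge0 ?(ltW radius_gt0).
  split; last lra.
  apply: (le_trans (correction_norm gU gD _)); lra.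
Qed.

Definition phi_sums k := (picard_sum k).1.
Definition psi_sums k := (picard_sum k).2.
Definition phi_steps k := (picard_step k).1.
Definition psi_steps k := (picard_step k).2.

Lemma phi_series : exp_series lam radius phi_sums phi_steps.
Proof.
split=> // [k|k p]; have [_ [gD _] n] := picard_bounds k; first exact: gD.
have [+ _] := n p; apply: le_trans.
by rewrite lerDl es_norm_ge0.
Qed.

Lemma psi_series : exp_series mu radius psi_sums psi_steps.
Proof.
split=> // [k|k p]; have [_ [_ gD] n] := picard_bounds k; first exact: gD.
have [+ _] := n p; apply: le_trans.
by rewrite lerDr es_norm_ge0.
Qed.

Lemma solve1_ode s p t : expsum floor1 s ->
  pairing (fun nu => charpoly c phi_mass p nu * expmono 0 t nu)
    (solve c phi_mass s) p =
  es_eval s p t.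
Proof. exact: (solve_ode phi_mass_ge0 gap_gt0 charpoly1_ge). Qed.

Lemma solve2_ode s p t : expsum floor2 s ->
  pairing (fun nu => charpoly c eps p nu * expmono 0 t nu)
    (solve c eps s) p =
  es_eval s p t.
Proof. exact: (solve_ode eps_ge0 gap_gt0 charpoly2_ge). Qed.

(** The linear operator applied to a sum equals the nonlinearity at the
    preceding sum, as in an ordinary Picard iteration. *)
Lemma picard_ode1 k p t :
  pairing (fun nu => charpoly c phi_mass p nu * expmono 0 t nu)
    (phi_sums k.+1) p =
  es_eval (phi_sums k) p t *
    (es_eval (phi_sums k) p t - r * es_eval (psi_sums k) p (t - c p * h)).
Proof.
elim: k => [|k IH].
  rewrite /es_eval /pairing /phi_sums /picard_sum /picard /=.
  rewrite big_seq1 big_nil mul0r /=.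
  by rewrite (charpoly_root c phi_mass_ge0) mul0r mulr0.
have [gU gD _] := picard_bounds k.
have -> : phi_sums k.+2 = phi_sums k.+1 ++ phi_steps k.+1 by [].
rewrite pairing_cat IH /phi_steps /picard_step picardS [(_, _).2]/=.
rewrite solve1_ode;
  last exact: expsum_source1.
have -> : phi_sums k.+1 = phi_sums k ++ phi_steps k by [].
have -> : psi_sums k.+1 = psi_sums k ++ psi_steps k by [].
rewrite !es_eval_cat !es_eval_nonlin1 !es_eval_cat.
rewrite -/(phi_sums k) -/(psi_sums k) -/(phi_steps k) -/(psi_steps k); ring.
Qed.

Lemma picard_ode2 k p t :
  pairing (fun nu => charpoly c eps p nu * expmono 0 t nu) (psi_sums k.+1) p =
  - b * es_eval (phi_sums k.+1) p t +
  (b * es_eval (phi_sums k) p t - eps p * es_eval (psi_sums k) p t) *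
    es_eval (psi_sums k) p t.
Proof.
elim: k => [|k IH].
  have [g1 _] := linear_part_admissible.
  have -> : psi_sums 1 =
    solve c eps (scale (fun=> - b) [:: (A, lam)]) ++ [:: (B, mu)] by [].
  have -> : phi_sums 1 = [:: (A, lam)] by [].
  rewrite pairing_cat solve2_ode; last exact: expsum_coupling.
  rewrite es_eval_scale [X in _ + X = _]/pairing big_seq1 /=.
  rewrite (charpoly_root c eps_ge0).
  by rewrite [es_eval (psi_sums 0) p t]/es_eval /pairing big_nil !mul0r !mulr0.
have [gU gD _] := picard_bounds k.
have [g1 _] := correction_admissible gU gD.
have -> : psi_sums k.+2 = psi_sums k.+1 ++ psi_steps k.+1 by [].
rewrite pairing_cat IH /psi_steps /picard_step picardS [(_, _).2]/=.
rewrite solve2_ode;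
  last exact: expsum_source2.
have -> : phi_sums k.+2 =
  phi_sums k.+1 ++ (correction (picard_sum k) (picard_step k)).1 by [].
have -> : phi_sums k.+1 = phi_sums k ++ phi_steps k by [].
have -> : psi_sums k.+1 = psi_sums k ++ psi_steps k by [].
rewrite !es_eval_cat !es_eval_nonlin2 !es_eval_scale !es_eval_cat.
rewrite -/(phi_sums k) -/(psi_sums k) -/(phi_steps k) -/(psi_steps k); ring.
Qed.

Lemma picard_at0 k p :
  es_eval (phi_sums k.+1) p 0 = A p /\ es_eval (psi_sums k.+1) p 0 = B p.
Proof.
elim: k => [|k [IH1 IH2]].
  have -> : psi_sums 1 =
    solve c eps (scale (fun=> - b) [:: (A, lam)]) ++ [:: (B, mu)] by [].
  have -> : phi_sums 1 = [:: (A, lam)] by [].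
  rewrite es_eval_cat [es_eval (solve _ _ _) _ _]solve_at0.
  rewrite /es_eval /pairing !big_seq1 /=.
  by rewrite !expmono00 !mulr1 add0r.
have -> : psi_sums k.+2 =
  psi_sums k.+1 ++ (correction (picard_sum k) (picard_step k)).2 by [].
have -> : phi_sums k.+2 =
  phi_sums k.+1 ++ (correction (picard_sum k) (picard_step k)).1 by [].
rewrite (es_eval_cat (phi_sums k.+1)) (es_eval_cat (psi_sums k.+1)) IH1 IH2.
by rewrite [es_eval (correction _ _).1 _ _]solve_at0
  [es_eval (correction _ _).2 _ _]solve_at0 !addr0.
Qed.

Definition phi k p t := es_value phi_sums k p t.
Definition psi k p t := es_value psi_sums k p t.

Lemma phi_cvg k p t : t <= 0 ->
  pairing (expmono k t) (phi_sums m) p @[m --> \oo] --> phi k p t.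
Proof. exact: (es_value_cvg phi_series lam_ge0). Qed.

Lemma psi_cvg k p t : t <= 0 ->
  pairing (expmono k t) (psi_sums m) p @[m --> \oo] --> psi k p t.
Proof. exact: (es_value_cvg psi_series mu_ge0). Qed.

Lemma pairing_charpoly (m : P -> R) s p t :
  pairing (fun nu => charpoly c m p nu * expmono 0 t nu) s p =
  pairing (expmono 2 t) s p - c p * pairing (expmono 1 t) s p -
    m p * pairing (expmono 0 t) s p.
Proof.
rewrite /pairing !mulr_sumr -!sumrB; apply: eq_bigr => x _.
by rewrite /charpoly /expmono; ring.
Qed.

Lemma phi_ode p t : t <= 0 ->
  phi 2 p t - c p * phi 1 p t - phi_mass p * phi 0 p t =
  phi 0 p t * (phi 0 p t - r * psi 0 p (t - c p * h)).
Proof.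
move=> t0.
have t1 : t - c p * h <= 0.
  by rewrite subr_le0 (le_trans t0)// mulr_ge0 ?(ltW (c_gt0 p)) ?(ltW hh).
have lhs : pairing (fun nu => charpoly c phi_mass p nu * expmono 0 t nu)
      (phi_sums m) p @[m --> \oo] -->
    phi 2 p t - c p * phi 1 p t - phi_mass p * phi 0 p t.
  under eq_fun do rewrite pairing_charpoly.
  apply: cvgB; first apply: cvgB; first exact: phi_cvg.
    by apply: cvgMr; exact: phi_cvg.
  by apply: cvgMr; exact: phi_cvg.
move: lhs; rewrite -cvg_shiftS.
under eq_fun do rewrite picard_ode1.
move=> lhs; apply: (cvg_unique _ lhs) => //.
apply: cvgM; first exact: phi_cvg.
apply: cvgB; first exact: phi_cvg.
by apply: cvgMr; exact: psi_cvg.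
Qed.

Lemma psi_ode p t : t <= 0 ->
  psi 2 p t - c p * psi 1 p t - eps p * psi 0 p t =
  - b * phi 0 p t + (b * phi 0 p t - eps p * psi 0 p t) * psi 0 p t.
Proof.
move=> t0.
have lhs : pairing (fun nu => charpoly c eps p nu * expmono 0 t nu)
      (psi_sums m) p @[m --> \oo] -->
    psi 2 p t - c p * psi 1 p t - eps p * psi 0 p t.
  under eq_fun do rewrite pairing_charpoly.
  apply: cvgB; first apply: cvgB; first exact: psi_cvg.
    by apply: cvgMr; exact: psi_cvg.
  by apply: cvgMr; exact: psi_cvg.
move: lhs; rewrite -cvg_shiftS.
under eq_fun do rewrite picard_ode2.
move=> lhs; apply: (cvg_unique _ lhs) => //.
have pc := @phi_cvg 0 p t t0.
apply: cvgD.
  by apply: cvgMr; move: pc; rewrite -cvg_shiftS.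
apply: cvgM; last exact: psi_cvg.
by apply: cvgB; apply: cvgMr; [exact: phi_cvg|exact: psi_cvg].
Qed.

Lemma phi_at0 p : phi 0 p 0 = A p.
Proof.
have := @phi_cvg 0 p 0 (lexx 0); rewrite -cvg_shiftS.
under eq_fun do rewrite [pairing _ _ _](picard_at0 _ p).1.
by move=> /cvg_lim <- //; rewrite lim_cst.
Qed.

Lemma psi_at0 p : psi 0 p 0 = B p.
Proof.
have := @psi_cvg 0 p 0 (lexx 0); rewrite -cvg_shiftS.
under eq_fun do rewrite [pairing _ _ _](picard_at0 _ p).2.
by move=> /cvg_lim <- //; rewrite lim_cst.
Qed.

Lemma wave_solution p : profile_solution r b h (c p) (eps p) `]-oo, 0]
  (phi 0 p) (phi 1 p) (psi 0 p) (psi 1 p).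
Proof.
exists (phi 2 p), (psi 2 p); split.
- exact: (es_value_C2 phi_series lam_ge0).
- exact: (es_value_C2 psi_series mu_ge0).
- move=> t; rewrite /= in_itv /= => t0.
  have e1 := @phi_ode p t t0; have e2 := @psi_ode p t t0.
  rewrite /phi_mass in e1.
  split; [move: e1|move: e2] => /eqP; rewrite -subr_eq0 => /eqP e;
  rewrite -[RHS]e; ring.
Qed.

Lemma lam_ge p : c0 <= lam p.
Proof. exact: le_trans (mu_ge p) (mu_le_lam p). Qed.

(** The delayed argument t + s lies to the left of t, where the bound is even
    smaller. *)
Lemma wave_decay p :
  exp_decay h (phi 0 p) (phi 1 p) (psi 0 p) (psi 1 p).
Proof.
exists (2 * radius), c0; split=> // t t0.
have d1 : 0 <= c0 <= lam p by rewrite ltW// lam_ge.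
have d2 : 0 <= c0 <= mu p by rewrite ltW// mu_ge.
split.
- by have := es_value_decay phi_series 0 d1 t0; rewrite mul1r.
- by have := es_value_decay phi_series 1 d1 t0; rewrite mul1r.
- move=> s /andP[_ s0]; have st : t + s <= 0 by lra.
  have := es_value_decay psi_series 0 d2 st; rewrite mul1r.
  move=> /le_trans; apply; rewrite ler_wpM2l ?mulr_ge0 ?(ltW radius_gt0)//.
  by rewrite ler_expR ler_wpM2l ?(ltW hc0)//; lra.
- by have := es_value_decay psi_series 1 d2 t0; rewrite mul1r.
Qed.

Lemma psi_continuous p :
  continuous (sigL `[- (2 * h), 0]%classic (psi 0 p)).
Proof.
apply/subspace_sigL_continuousP.
apply: (@lipschitz_within_continuous _ _ _ (2 * (1`!%:R * radius))) => s t.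
rewrite /= !in_itv /= => /andP[_ s0] /andP[_ t0].
exact: (es_value_lipschitz psi_series mu_ge0).
Qed.

Definition psi_history p : history h := mkcts (@psi_continuous p).

Definition manifold_point p : phase h :=
  (phi 0 p 0, phi 1 p 0, psi_history p, psi 1 p 0).

Lemma psi_history_continuous : continuous psi_history.
Proof.
move=> p0; apply: history_cvg => e e_gt0.
have : \forall p \near p0, forall t, `[- (2 * h), 0]%classic t ->
    `|psi 0 p0 t - psi 0 p t| < e.
  apply: (es_value_near psi_series mu_ge0) => // [t|k d d0].
    by rewrite /= !in_itv /= => /andP[].
  have h2 : 0 <= 2 * h by rewrite mulr_ge0 ?(ltW hh).
  have := pairing_expR_near p0 mu_ge0
    (@exp_series_expsum _ _ _ _ _ _ psi_series k) h2 d0.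
  by apply: filterS => p pd t; rewrite /= in_itv /=; exact: pd.
apply: filterS => p pe s; apply: pe.
exact: set_valP.
Qed.

Lemma manifold_point_continuous : continuous manifold_point.
Proof.
have h1 : continuous (fun p => phi 0 p 0).
  by under eq_fun do rewrite phi_at0; exact: A_cont.
have h2 : continuous (fun p => phi 1 p 0).
  exact: (es_value_continuous phi_series lam_ge0).
have h4 : continuous (fun p => psi 1 p 0).
  exact: (es_value_continuous psi_series mu_ge0).
move=> p; exact: (cvg_pair (cvg_pair (cvg_pair (h1 p) (h2 p))
  (@psi_history_continuous p)) (h4 p)).
Qed.

Lemma manifold_point_unstable p :
  strongly_unstable_manifold r b h (c p) (eps p) (manifold_point p).
Proof.
exists (phi 0 p), (phi 1 p), (psi 0 p), (psi 1 p), (psi_history p).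
by split; [exact: wave_solution|exact: wave_decay| |].
Qed.

(** The parameter space P is arbitrary; continuity and bounds are asked for on
    all of it, which is what clamping the coordinates of a point provides. *)
Theorem unstable_manifold_family : exists Gamma : P -> phase h,
  [/\ continuous Gamma,
      forall p, (Gamma p).1.1.1 = A p,
      forall p x, set_val x = 0 -> history_fun (Gamma p).1.2 x = B p &
      forall p, strongly_unstable_manifold r b h (c p) (eps p) (Gamma p)].
Proof.
exists manifold_point; split.
- exact: manifold_point_continuous.
- exact: phi_at0.
- by move=> p x x0; rewrite -psi_at0 -[in RHS]x0.
- exact: manifold_point_unstable.
Qed.

End WaveSeries.

(** * The local strongly unstable manifold *)

Section Clamp.
Context {R : realType}.

(** Clamped parameters satisfy the required bounds everywhere and agree with
    the given ones on the region of interest, so that the map is continuous on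
    the whole space. *)
Definition clamp (lo hi x : R) := Num.max lo (Num.min hi x).

Lemma clamp_id lo hi x : lo <= x <= hi -> clamp lo hi x = x.
Proof. by move=> /andP[l u]; rewrite /clamp min_r// max_r. Qed.

Lemma clamp_bounds lo hi x : lo <= hi -> lo <= clamp lo hi x <= hi.
Proof. by move=> lh; rewrite /clamp le_max lexx /= ge_max lh ge_min lexx. Qed.

Lemma clamp_continuous (T : topologicalType) lo hi (f : T -> R) :
  continuous f -> continuous (fun x => clamp lo hi (f x)).
Proof.
move=> fc x; apply: (@continuous_max R T (fun=> lo)); first exact: cvg_cst.
by apply: (@continuous_min R T (fun=> hi)); [exact: cvg_cst|exact: fc].
Qed.
End Clamp.

Theorem theorem3p1 (R : realType) (r b h : R)
    (hr : 1 < r) (hb : 0 < b) (hh : 0 < h)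
    (cs : R -> R) (phis psis : R -> R -> R)
    (hwave : \forall eps \near 0^'+,
       monotone_wavefront r b h (cs eps) eps (phis eps) (psis eps))
    (cstar : R)
    (hcstar : limf_einf (fun eps : R => (cs eps)%:E) (0 : R)^'+ = cstar%:E)
    (cstar_bounds : 0 < cstar < 2) :
  exists (O : set (R * R)) (eps0 : R) (gamma : R * R * (R * R) -> phase h),
    [/\ open O /\ O (0, 0),
        0 < eps0 < 1,
        {within (`[0, eps0] `*` `[3 / 4 * cstar, 2]) `*` O,
          continuous gamma} &
        forall eps c : R, 0 <= eps <= eps0 ->
          3 / 4 * cstar <= c <= 2 ->
          embedding_on O (fun x => gamma (eps, c, x)) /\
          (fun x => gamma (eps, c, x)) @` O
            `<=` strongly_unstable_manifold r b h c eps].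
Proof.
have /andP[cs0 cs2] := cstar_bounds.
pose c0 := 3 / 4 * cstar; pose eps0 := Num.min (1 / 2) ((r - 1) / 2).
have c0_gt0 : 0 < c0 by rewrite /c0; lra.
have c0_le2 : c0 <= 2 by rewrite /c0; lra.
have eps0_gt0 : 0 < eps0 by rewrite lt_min; apply/andP; split; lra.
have eps0_lt1 : eps0 < 1 by rewrite gt_min; apply/orP; left; lra.
have eps0_gap : eps0 <= (r - 1) / 2 by rewrite ge_min lexx orbT.
pose a := amplitude r b c0.
have a_gt0 : 0 < a by exact: amplitude_gt0.
pose P : topologicalType := (R * R * (R * R))%type.
have fst_c (X Y : topologicalType) : continuous (@fst X Y).
  by move=> ?; exact: cvg_fst.
have snd_c (X Y : topologicalType) : continuous (@snd X Y).
  by move=> ?; exact: cvg_snd.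
have comp_c (X Y Z : topologicalType) (f : X -> Y) (g : Y -> Z) :
    continuous f -> continuous g -> continuous (fun x => g (f x)).
  by move=> fc gc x; apply: continuous_comp; [exact: fc|exact: gc].
pose eps' (p : P) := clamp 0 eps0 p.1.1.
pose c' (p : P) := clamp c0 2 p.1.2.
pose A (p : P) := clamp (- a) a p.2.1.
pose B (p : P) := clamp (- a) a p.2.2.
have eps'_c : continuous eps'.
  by apply: clamp_continuous; apply: comp_c (@fst_c _ _) (@fst_c _ _).
have c'_c : continuous c'.
  by apply: clamp_continuous; apply: comp_c (@fst_c _ _) (@snd_c _ _).
have A_c : continuous A.
  by apply: clamp_continuous; apply: comp_c (@snd_c _ _) (@fst_c _ _).
have B_c : continuous B.
  by apply: clamp_continuous; apply: comp_c (@snd_c _ _) (@snd_c _ _).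
have aa : - a <= a by lra.
have c'_b p : c0 <= c' p <= 2 by exact: clamp_bounds.
have eps'_b p : 0 <= eps' p <= eps0 by apply: clamp_bounds; exact: ltW.
have A_b p : `|A p| <= a by rewrite ler_norml; exact: clamp_bounds.
have B_b p : `|B p| <= a by rewrite ler_norml; exact: clamp_bounds.
have [Gamma [Gc GA GB GU]] := unstable_manifold_family hr hb hh c0_gt0
  eps'_c c'_c A_c B_c c'_b (ltW eps0_lt1) eps0_gap eps'_b A_b B_b.
exists (ball (0, 0) a), eps0, Gamma; split.
- by split; [exact: ball_open|exact: ballxx].
- by rewrite eps0_gt0.
- exact: continuous_subspaceT.
move=> eps c heps hc.
have AB x : ball ((0, 0) : R * R) a x ->
    A (eps, c, x) = x.1 /\ B (eps, c, x) = x.2.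
  rewrite /A /B => -[] /=; rewrite /ball /= !sub0r !normrN !ltr_norml.
  move=> /andP[? ?] /andP[? ?].
  by split; apply: clamp_id; rewrite !ltW.
have zh : (0 : R) \in `[- (2 * h), 0]%classic.
  by rewrite inE /= in_itv /= lexx oppr_le0 mulr_ge0 ?(ltW hh).
pose z : set_type `[- (2 * h), 0]%classic := exist _ 0 zh.
split; last first.
  move=> _ [x /AB[Ax Bx] <-].
  have := GU (eps, c, x).
  by rewrite /eps' /c' !clamp_id.
(* The left inverse reads off phi(0) and psi(0), which are the parameters. *)
exists (fun q => (q.1.1.1, history_fun q.1.2 z)); split.
- apply: continuous_subspaceT; apply: (comp_c _ _ _ _ _ _ Gc) => x.
  exact: (cvg_pair (cvg_cst (eps, c)) cvg_id).
- pose X : topologicalType := (R * R * history h)%type.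
  have f1 : continuous (fst : phase h -> X) := @fst_c X R.
  have g1 : continuous (fun q : X => q.1.1) :=
    comp_c X _ R fst fst (@fst_c _ _) (@fst_c _ _).
  have g2 : continuous (fun q : X => history_fun q.2 z) :=
    comp_c X _ R snd _ (@snd_c _ _) (@history_fun_continuous _ _ z).
  have h1 : continuous (fun q : phase h => q.1.1.1) := comp_c _ _ _ _ _ f1 g1.
  have h2 : continuous (fun q : phase h => history_fun q.1.2 z) :=
    comp_c _ _ _ _ _ f1 g2.
  by apply: continuous_subspaceT => q; exact: (cvg_pair (h1 q) (h2 q)).
- move=> x /set_mem /AB[Ax Bx] /=.
  by rewrite GA (GB _ z)// Ax Bx; case: x {Ax Bx}.
Qed.
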